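(* Let $\theta>0$ and $n\ge2$. Under the Ewens-like distribution for records with parameter $\theta$ on $\mathfrak{S}_n$, for every $i\in\{2,\dots,n\}$, $$\mathbb{P}_n\big(\sigma(i-1)>\sigma(i)\big)=\frac{(i-1)(2\theta+i-2)}{2(\theta+i-1)(\theta+i-2)}.$$
   Context: $\mathfrak{S}_n$ is the set of permutations of $[n]=\{1,\dots,n\}$. A permutation $\sigma$ has a record at position $i$ if $\sigma(i)>\sigma(j)$ for all $j<i$; $\mathrm{rec}(\sigma)$ is the number of records. The Ewens-like distribution for records with parameter $\theta>0$ gives each $\sigma\in\mathfrak{S}_n$ probability proportional to $\theta^{\mathrm{rec}(\sigma)}$; $\mathbb{P}_n$ denotes probability under it. *)

(* Defs.v *)
From mathcomp Require Import all_boot all_order all_fingroup all_algebra.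
Set Implicit Arguments.
Unset Strict Implicit.
Unset Printing Implicit Defensive.
Import Order.TTheory GRing.Theory Num.Theory.
Local Open Scope ring_scope.

(* 'S_n permutes 'I_n = {0, .., n - 1}; the ordinal j stands for the element
   j + 1 of [n] = {1, .., n}, both as a position and as a value. *)

Definition is_record (n : nat) (s : 'S_n) (i : 'I_n) : bool :=
  [forall j : 'I_n, (j < i)%N ==> (s j < s i)%N].

Definition rec (n : nat) (s : 'S_n) : nat := #|[set i : 'I_n | is_record s i]|.

(* s(i) in one-line notation on [n], for 1 <= i <= n; the value 0 is used for
   i outside [n]. *)
Definition one_line (n : nat) (s : 'S_n) (i : nat) : nat :=
  if i is k.+1 then
    if insub k is Some j then (s (j : 'I_n) : nat).+1 else 0%N
  else 0%N.

Definition ewens_pmf (R : realFieldType) (theta : R) (n : nat) (s : 'S_n) : R :=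
  theta ^+ rec s / \sum_(t : 'S_n) theta ^+ rec t.

Definition ewens_prob (R : realFieldType) (theta : R) (n : nat)
    (A : {set 'S_n}) : R :=
  \sum_(s in A) ewens_pmf theta s.

(* Main.v *)
Require Import Defs.
From mathcomp Require Import all_boot all_order all_fingroup all_algebra.
From mathcomp Require Import ring.
Set Implicit Arguments.
Unset Strict Implicit.
Unset Printing Implicit Defensive.
Import Order.TTheory GRing.Theory Num.Theory.
Local Open Scope ring_scope.

(** Deleting the last entry of a permutation of [n + 1] and standardizing gives
    a bijection onto pairs (last value, permutation of [n]); it preserves the
    earlier records and descents, and the deleted entry is a record iff it is
    the maximum. So the total weight of any event on the relative order of the
    first n entries is multiplied by theta + n when passing from n to n + 1,
    which reduces the claim to i = n, and there deleting two entries leaves a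
    sum over the pairs of last values. *)

Lemma ltn_lift {n} (v : 'I_n.+1) (a b : 'I_n) : (lift v a < lift v b)%N = (a < b)%N.
Proof. by rewrite /= !ltnNge leq_bump2. Qed.

(** Both sides have (n + 1)! elements, so injectivity suffices: the image of [ord_max] gives back
    [v], and then [lift v] can be cancelled. *)
Lemma lift_perm_max_bij n :
  bijective (fun p : 'I_n.+1 * 'S_n => lift_perm ord_max p.1 p.2).
Proof.
apply: inj_card_bij => [[v t] [w u] /= e|].
  have vw : v = w by rewrite -(lift_perm_id ord_max v t) e lift_perm_id.
  subst w; congr (_, _); apply/permP => k; apply: (@lift_inj _ v).
  by rewrite -!(lift_perm_lift ord_max) e.
by rewrite card_prod !card_Sn card_ord factS.
Qed.

(** The map [lift v] is increasing, and the appended position comes after every old one, so it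
    enters no earlier record condition. *)
Lemma is_record_lift n (v : 'I_n.+1) (t : 'S_n) (k : 'I_n) :
  is_record (lift_perm ord_max v t) (lift ord_max k) = is_record t k.
Proof.
apply/forallP/forallP => H j; apply/implyP => jk.
  by have := H (lift ord_max j); rewrite !lift_perm_lift !ltn_lift jk.
case: (unliftP ord_max j) jk => [j' ->|->].
  by rewrite !lift_perm_lift !ltn_lift; apply/implyP: (H j').
by rewrite lift_max ltnNge ltnW.
Qed.

Lemma is_record_last n (v : 'I_n.+1) (t : 'S_n) :
  is_record (lift_perm ord_max v t) ord_max = (v == ord_max).
Proof.
apply/forallP/eqP => [H|-> j].
  apply/eqP/contraT => vmax.
  (* If [v] is not the maximum, the maximum is [lift v w] for some [w], attained at the earlier
     position [t^-1 w]; this contradicts the record. *)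
  have [w maxw _] : {w | ord_max = lift v w & unlift v ord_max = Some w}.
    by apply: unlift_some.
  have := H (lift ord_max (t^-1%g w)).
  by rewrite lift_perm_id lift_perm_lift permKV -maxw lift_max ltn_ord ltnNge -ltnS ltn_ord.
apply/implyP; rewrite lift_perm_id; case: (unliftP ord_max j) => [k ->|->]; last by rewrite ltnn.
by rewrite lift_perm_lift !lift_max !ltn_ord.
Qed.

Lemma rec_lift n (v : 'I_n.+1) (t : 'S_n) :
  rec (lift_perm ord_max v t) = ((v == ord_max) + rec t)%N.
Proof.
have recE m (s : 'S_m) : rec s = (\sum_(i < m) is_record s i)%N.
  by rewrite /rec -sum1dep_card big_mkcond; apply: eq_bigr => i _; case: is_record.
rewrite !recE big_ord_recr /= is_record_last addnC; congr addn.
apply: eq_bigr => k _; rewrite -(is_record_lift v); congr (nat_of_bool (is_record _ _)).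
by apply: ord_inj; rewrite lift_max.
Qed.

Section Weight.
Variables (R : realFieldType) (theta : R).

Lemma weight_recr n (P : pred 'S_n.+1) :
  \sum_(s | P s) theta ^+ rec s =
  \sum_(v < n.+1) theta ^+ (v == ord_max) *
    \sum_(t : 'S_n | P (lift_perm ord_max v t)) theta ^+ rec t.
Proof.
rewrite (reindex _ (onW_bij _ (lift_perm_max_bij n))) /=.
rewrite big_mkcond -(pair_bigA _ (fun v t => if P (lift_perm ord_max v t)
  then theta ^+ rec (lift_perm ord_max v t) else 0)) /=.
apply: eq_bigr => v _; rewrite -big_mkcond mulr_sumr.
by apply: eq_bigr => t _; rewrite rec_lift exprD.
Qed.

Lemma sum_theta_max n : \sum_(v < n.+1) theta ^+ (v == ord_max) = theta + n%:R.
Proof.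
rewrite big_ord_recr /= eqxx addrC; congr (_ + _).
rewrite (eq_bigr (fun=> 1)) ?sumr_const ?card_ord // => v _.
by rewrite -val_eqE /= ltn_eqF.
Qed.

Lemma weight_lift n (P : pred 'S_n.+1) (Q : pred 'S_n) :
  (forall v t, P (lift_perm ord_max v t) = Q t) ->
  \sum_(s | P s) theta ^+ rec s = (theta + n%:R) * \sum_(t | Q t) theta ^+ rec t.
Proof.
move=> PQ; rewrite weight_recr -sum_theta_max mulr_suml.
by apply: eq_bigr => v _; congr (_ * _); apply: eq_bigl => t.
Qed.

End Weight.

Lemma one_line_ord n (s : 'S_n) (k : 'I_n) : one_line s k.+1 = (s k).+1.
Proof. by rewrite /= valK. Qed.

Lemma descent_lift n (v : 'I_n.+1) (t : 'S_n) i : (0 < i)%N -> (i < n)%N ->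
  (one_line (lift_perm ord_max v t) i.+1 < one_line (lift_perm ord_max v t) i)%N
  = (one_line t i.+1 < one_line t i)%N.
Proof.
case: i => // i _ lt_i1n; have lt_in := ltnW lt_i1n.
have E k (lt_kn : (k < n)%N) :
  one_line (lift_perm ord_max v t) k.+1 = (lift v (t (Ordinal lt_kn))).+1.
  by rewrite -(lift_perm_lift ord_max) -one_line_ord lift_max.
rewrite (E _ lt_in) (E _ lt_i1n) !ltnS ltn_lift.
by rewrite (one_line_ord t (Ordinal lt_in)) (one_line_ord t (Ordinal lt_i1n)).
Qed.

(** The last value is [v] and the one before it is [lift v u], which equals u + 1 if v <= u and u
    otherwise. *)
Lemma descent_last n (v : 'I_n.+2) (u : 'I_n.+1) (t : 'S_n) :
  let s := lift_perm ord_max v (lift_perm ord_max u t) in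
  (one_line s n.+2 < one_line s n.+1)%N = (v <= u)%N.
Proof.
move=> s; rewrite (one_line_ord s ord_max).
have -> : one_line s n.+1 = (s (lift ord_max ord_max)).+1.
  by rewrite -one_line_ord lift_max.
rewrite /s lift_perm_id !lift_perm_lift lift_perm_id ltnS /= /bump.
by case: (leqP v u) => // uv; rewrite ltnNge ltnW.
Qed.

Lemma sum_last_descent (R : realFieldType) (theta : R) n :
  2 * \sum_(v < n.+2) theta ^+ (v == ord_max) *
    \sum_(u < n.+1 | (v <= u)%N) theta ^+ (u == ord_max)
  = n.+1%:R * (2 * theta + n%:R).
Proof.
have -> : \sum_(v < n.+2) theta ^+ (v == ord_max) *
    \sum_(u < n.+1 | (v <= u)%N) theta ^+ (u == ord_max)
  = \sum_(u < n.+1) theta ^+ (u == ord_max) * u.+1%:R.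
  rewrite (eq_bigr (fun v : 'I_n.+2 =>
      \sum_(u < n.+1 | (v <= u)%N) theta ^+ (u == ord_max))); last first.
    move=> v _; case: eqP => [->|_]; last by rewrite mul1r.
    by rewrite big_pred0 ?mulr0 // => u; rewrite leqNgt ltn_ord.
  (* Each [u] is now counted once for every v <= u, that is u + 1 times. *)
  rewrite (exchange_big_dep predT) //=; apply: eq_bigr => u _.
  rewrite sumr_const mulr_natr; congr (_ *+ _).
  rewrite -sum1_card -[RHS]card_ord -[RHS]sum1_card.
  rewrite [RHS](big_ord_widen n.+2 (fun=> 1%N)); first exact: eq_bigl.
  by rewrite ltnW // ltnS.
(* The top value u = n contributes theta * (n + 1); the others form a triangular number. *)
rewrite big_ord_recr /= eqxx expr1.
rewrite (eq_bigr (fun u : 'I_n => (u.+1)%:R)); last first.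
  by move=> u _; rewrite -val_eqE /= ltn_eqF ?mul1r.
have tri : 2 * \sum_(u < n) u.+1%:R = n%:R * n.+1%:R :> R.
  elim: n => [|n IHn]; first by rewrite big_ord0 mulr0 mul0r.
  by rewrite big_ord_recr /= mulrDr IHn; ring.
by rewrite mulrDr tri; ring.
Qed.

(** The descent depends only on the two deleted values, so the weight of the remaining permutation
    factors out of the sum over these values. *)
Lemma weight_descent_last (R : realFieldType) (theta : R) n :
  2 * \sum_(s : 'S_n.+2 | (one_line s n.+2 < one_line s n.+1)%N) theta ^+ rec s
  = n.+1%:R * (2 * theta + n%:R) * \sum_(t : 'S_n) theta ^+ rec t.
Proof.
rewrite -sum_last_descent -mulrA mulr_suml; congr (_ * _).
rewrite weight_recr; apply: eq_bigr => v _; rewrite -mulrA; congr (_ * _).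
rewrite weight_recr mulr_suml [RHS]big_mkcond; apply: eq_bigr => u _.
rewrite (eq_bigl (fun=> (v <= u)%N)) => [|t]; last exact: descent_last.
by case: ifP => _ //; rewrite big_pred0 ?mulr0.
Qed.

Lemma weight_gt0 (R : realFieldType) (theta : R) n :
  0 < theta -> 0 < \sum_(t : 'S_n) theta ^+ rec t.
Proof.
move=> theta_gt0; rewrite (bigD1 1%g) //=.
by apply: ltr_wpDr; [apply: sumr_ge0 => t _; apply/ltW|]; apply: exprn_gt0.
Qed.

Theorem theorem2 (R : realFieldType) (theta : R) (n i : nat)
    (theta_gt0 : 0 < theta) (n_ge2 : (2 <= n)%N) (i_bounds : (2 <= i <= n)%N) :
  ewens_prob theta [set s : 'S_n | (one_line s (i - 1) > one_line s i)%N]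
  = ((i%:R - 1) * (2 * theta + i%:R - 2))
    / (2 * (theta + i%:R - 1) * (theta + i%:R - 2)).
Proof.
case: i i_bounds => [|[|m]] // /andP[_ le_mn]; rewrite subn1 succnK.
rewrite /ewens_prob /ewens_pmf -mulr_suml.
under eq_bigl do rewrite inE.
have theta_nat_neq0 k : theta + k%:R != 0 by rewrite gt_eqF ?ltr_wpDr.
(* Induction on [n], with base n = i = m + 2, where the descent is at the end. *)
elim: n {n_ge2} le_mn => // n IHn; rewrite leq_eqVlt => /predU1P[[<-]|le_mn].
  have W_neq0 := lt0r_neq0 (weight_gt0 m theta_gt0).
  have two_neq0 : 2 != 0 :> R by rewrite pnatr_eq0.
  (* The inserted 2 lets [weight_descent_last] apply; reducing the normalizing sum twice then
     exposes the same weight on ['S_m], which cancels. *)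
  rewrite -[X in X / _](mulKf two_neq0) weight_descent_last.
  rewrite (@weight_lift _ _ _ _ predT) // (@weight_lift _ _ _ _ predT) //.
  have -> : m.+2%:R = m%:R + 2 :> R by ring.
  have -> : theta + (m%:R + 2) - 1 = theta + m.+1%:R by ring.
  have -> : theta + (m%:R + 2) - 2 = theta + m%:R by ring.
  by field; rewrite W_neq0 nat1r !theta_nat_neq0.
(* Numerator and normalizing sum both gain the factor theta + n, so the probability is unchanged. *)
rewrite (weight_lift _ (Q := fun t => (one_line t m.+2 < one_line t m.+1)%N)); last first.
  by move=> v t; apply: descent_lift.
rewrite (weight_lift _ (Q := predT)) // -mulf_div divff // mul1r.
exact: IHn.
Qed.
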